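(* Let $d\ge 1$ be an integer, let $G(x)=\sum_{\alpha\in\mathbb{N}^n,\ |\alpha|\le 2d}G_\alpha x^\alpha$ be a symmetric $m\times m$ matrix polynomial in $x\in\mathbb{R}^n$ of total degree $2d$ (the $G_\alpha$ are constant real symmetric matrices), and let $S=\{x\in\mathbb{R}^n: G(x)\succeq 0\}$. Let $L$ be the set defined by the moment-type semidefinite relaxation $$L=\Big\{x\in\mathbb{R}^n:\ \exists\, y\in\mathbb{R}^{\binom{n+2d}{2d}},\ \mathcal{G}(y)\succeq 0,\ \mathcal{A}_d(y)\succeq 0,\ y_0=1,\ x_1=y_{e_1},\ldots,x_n=y_{e_n}\Big\},$$ where $\mathcal{G}(y)=\sum_{|\alpha|\le 2d}y_\alpha G_\alpha$ and $\mathcal{A}_d(y)=\sum_{|\alpha|\le 2d}y_\alpha A^{(d)}_\alpha$. Suppose $G(\tilde x)\succ 0$ for some $\tilde x\in\mathbb{R}^n$. If $G(x)$ is matrix sos-concave, then $S=L$.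
   Context: $\mathbb{N}$ is the set of nonnegative integers; for $\alpha\in\mathbb{N}^n$, $|\alpha|=\alpha_1+\cdots+\alpha_n$ and $x^\alpha=x_1^{\alpha_1}\cdots x_n^{\alpha_n}$. $A\succeq 0$ (resp. $A\succ0$) means that the symmetric matrix $A$ is positive semidefinite (resp. positive definite). The vector $y$ is indexed by the multi-indices $\alpha\in\mathbb{N}^n$ with $|\alpha|\le 2d$; $e_i$ is the $i$-th standard unit vector, so $y_{e_i}$ is the entry of $y$ with index $e_i$, and $y_0$ is the entry with index $0\in\mathbb{N}^n$. $[x]_d$ is the column vector of all monomials in $x$ of degree at most $d$. The constant symmetric matrices $A_\alpha^{(d)}$ are determined by the identity $[x]_d[x]_d^T=\sum_{|\alpha|\le 2d}x^\alpha A_\alpha^{(d)}$. $\nabla_{xx}$ denotes the Hessian with respect to $x$. $G(x)$ is called matrix sos-concave if for every $\xi\in\mathbb{R}^m$ there exists a matrix polynomial $F_\xi(x)$ in $x$ (with $n$ columns and any finite number of rows) such that $-\nabla_{xx}(\xi^TG(x)\xi)=F_\xi(x)^TF_\xi(x)$. *)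

(* Defs.v *)
From HB Require Import structures.
From mathcomp Require Import all_boot all_order all_algebra.
From mathcomp Require Import classical_sets reals.
From mathcomp Require Export mpoly.

Set Implicit Arguments.
Unset Strict Implicit.
Unset Printing Implicit Defensive.

Import Order.TTheory GRing.Theory Num.Theory.
Local Open Scope ring_scope.
Local Open Scope classical_set_scope.

Definition psdmx (R : realType) (k : nat) (A : 'M[R]_k) : Prop :=
  A^T = A /\ forall v : 'cV[R]_k, 0 <= (v^T *m A *m v) 0 0.

Definition pdmx (R : realType) (k : nat) (A : 'M[R]_k) : Prop :=
  A^T = A /\ forall v : 'cV[R]_k, v != 0 -> 0 < (v^T *m A *m v) 0 0.

(* Matrix polynomials in n variables are matrices over {mpoly R[n]}. *)

Definition evalmx (R : realType) (n p q : nat) (M : 'M[{mpoly R[n]}]_(p, q))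
    (x : 'cV[R]_n) : 'M[R]_(p, q) :=
  \matrix_(i, j) (M i j).@[fun k => x k 0].

(* The constant matrix M_a in the expansion M = \sum_a 'X_[a] M_a. *)
Definition coefmx (R : realType) (n p q : nat) (M : 'M[{mpoly R[n]}]_(p, q))
    (a : 'X_{1..n}) : 'M[R]_(p, q) :=
  \matrix_(i, j) (M i j)@_a.

Definition mxdeg_le (R : realType) (n p q : nat) (M : 'M[{mpoly R[n]}]_(p, q))
    (k : nat) : Prop :=
  (* msize is the total degree plus one *)
  forall i j, (msize (M i j) <= k.+1)%N.

Lemma coefmxE (R : realType) (n p q : nat) (M : 'M[{mpoly R[n]}]_(p, q))
    (k : nat) : mxdeg_le M k ->
  M = \sum_(a : 'X_{1..n < k.+1}) 'X_[a] *: map_mx (@mpolyC n R) (coefmx M a).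
Proof.
move=> hM; apply/matrixP => i j; rewrite summxE {1}[M i j](mpolywE (hM i j)).
by apply: eq_bigr => a _; rewrite !mxE mulrC mul_mpolyC.
Qed.

Definition hessian (R : realType) (n : nat) (p : {mpoly R[n]}) :
    'M[{mpoly R[n]}]_n :=
  \matrix_(i, j) ((p^`M(j))^`M(i)).

Definition qform (R : realType) (n m : nat) (G : 'M[{mpoly R[n]}]_m)
    (xi : 'cV[R]_m) : {mpoly R[n]} :=
  ((map_mx (@mpolyC n R) xi)^T *m G *m map_mx (@mpolyC n R) xi) 0 0.

Definition matrix_sos_concave (R : realType) (n m : nat)
    (G : 'M[{mpoly R[n]}]_m) : Prop :=
  forall xi : 'cV[R]_m, exists (r : nat) (F : 'M[{mpoly R[n]}]_(r, n)),
    - hessian (qform G xi) = F^T *m F.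

(* The vector [x]_d; its rows are indexed, through enum_val, by the
   multi-indices of degree at most d. *)
Definition monvec (R : realType) (n d : nat) :
    'cV[{mpoly R[n]}]_#|{: 'X_{1..n < d.+1}}| :=
  \col_(i < _) 'X_[(enum_val i : 'X_{1..n < d.+1})].

Definition Amx (R : realType) (n d : nat) (a : 'X_{1..n}) :
    'M[R]_#|{: 'X_{1..n < d.+1}}| :=
  coefmx (monvec R n d *m (monvec R n d)^T) a.

Lemma AmxE (R : realType) (n d : nat) :
  monvec R n d *m (monvec R n d)^T =
  \sum_(a : 'X_{1..n < (2 * d).+1})
     'X_[a] *: map_mx (@mpolyC n R) (Amx R d a).
Proof.
apply: coefmxE => i j; rewrite mxE big_ord1 !mxE -mpolyXD msizeX ltnS mdegD.
rewrite mul2n -addnn leq_add // -ltnS; exact: bmdeg.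
Qed.

(* Truncated moment vectors y are families indexed by 'X_{1..n < (2 * d).+1},
   i.e. by the multi-indices of degree at most 2d. *)

Definition Gmom (R : realType) (n m d : nat) (G : 'M[{mpoly R[n]}]_m)
    (y : {ffun 'X_{1..n < (2 * d).+1} -> R}) : 'M[R]_m :=
  \sum_a y a *: coefmx G a.

Definition Amom (R : realType) (n d : nat)
    (y : {ffun 'X_{1..n < (2 * d).+1} -> R}) :
    'M[R]_#|{: 'X_{1..n < d.+1}}| :=
  \sum_a y a *: Amx R d a.

(* The index e_i. For d = 0 it is out of range and the value is junk. *)
Definition bm1 (n d : nat) (i : 'I_n) : 'X_{1..n < (2 * d).+1} :=
  insubd bm0 U_(i)%MM.

Lemma bm1E (n d : nat) (i : 'I_n) : (0 < d)%N ->
  bm1 d i = U_(i)%MM :> 'X_{1..n}.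
Proof. by move=> d0; rewrite /bm1 insubdK // unfold_in /= mdeg1 ltnS muln_gt0. Qed.

Definition Sset (R : realType) (n m : nat) (G : 'M[{mpoly R[n]}]_m) :
    set 'cV[R]_n :=
  [set x | psdmx (evalmx G x)].

Definition Lset (R : realType) (n m d : nat) (G : 'M[{mpoly R[n]}]_m) :
    set 'cV[R]_n :=
  [set x | exists y : {ffun 'X_{1..n < (2 * d).+1} -> R},
     [/\ psdmx (Gmom G y), psdmx (Amom y), y bm0 = 1
       & forall i, x i 0 = y (bm1 d i)]].

(* Main.v *)
Require Import Defs.
From mathcomp Require Import all_boot all_order all_algebra.
From mathcomp Require Import classical_sets reals.
From HB Require Import structures.
From mathcomp Require Import ring polyrcf.

(** If [x] lies in [S], the vector [y_a = x^a] of monomial values witnesses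
    that [x] lies in [L].  All the content is in the converse, which is a
    Jensen inequality.  A truncated moment vector [y] is the same thing as the
    linear functional [riesz y : p |-> \sum_a y_a p_a], and
    - [A_d(y) >= 0] says that the functional is nonnegative on the squares of
      the polynomials of degree at most [d];
    - [xi^T G(y) xi] is its value at the polynomial [xi^T G xi].
    If every sos-convex [f] of degree at most [2d] satisfies
    [f(L X_1, ..., L X_n) <= L f] for such functionals [L] (lemma [jensen]),
    then [f = - xi^T G xi] gives [xi^T G(x) xi >= xi^T G(y) xi >= 0] for every
    [xi], that is [G(x) >= 0].

    For the Jensen inequality one translates the point [(L X_1, ..., L X_n)] to
    the origin, so that [L X_i = 0], and restricts everything to dilations:
    [phi(s) = L (f(s X))] is a polynomial in the single variable [s] (its
    definition is [radial]), with [phi(0) = f(0)], [phi(1) = L f] and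
    [phi'(0) = \sum_i f_(e_i) L X_i = 0].  The second Euler operator
    [euler2 f = \sum_(i, j) X_i X_j d_i d_j f] multiplies a monomial of degree
    [k] by [k (k - 1)], whence [s^2 phi''(s) = L ((euler2 f)(s X))].  If the
    Hessian of [f] is [F^T F], then [euler2 f] is the sum of the squares of the
    entries of [F X]; it has degree at most [2d], and since leading
    coefficients of squares cannot cancel ([msize_sos]), each entry has degree
    at most [d].  So [phi'' >= 0] on the positive reals, and two applications of
    the mean value theorem give [phi(0) <= phi(1)].  Working with [phi] replaces
    the usual representation of [f(z) - f(x) - f'(x)(z - x)] as an integral of
    sums of squares, which would require interchanging [L] with an integral. *)

Set Implicit Arguments.
Unset Strict Implicit.
Unset Printing Implicit Defensive.
Import Order.TTheory GRing.Theory Num.Theory.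
Local Open Scope ring_scope.

(** * Affine substitutions *)

(** Translations ([s = 1]) and dilations ([b = 0]) are treated together, since
    both need the same degree bound. *)
Definition affsub (R : comNzRingType) (n : nat) (s : R) (b : 'I_n -> R) :
    n.-tuple {mpoly R[n]} :=
  [tuple s *: 'X_i + (b i)%:MP | i < n].

Lemma comp_affsubX (R : comNzRingType) (n : nat) (s : R) (b : 'I_n -> R) i :
  'X_i \mPo affsub s b = s *: 'X_i + (b i)%:MP.
Proof. by rewrite comp_mpolyXU -tnth_nth tnth_mktuple. Qed.

Lemma msize_comp_affsub (R : comNzRingType) (n : nat) (s : R) (b : 'I_n -> R)
    (p : {mpoly R[n]}) :
  (msize (p \mPo affsub s b) <= msize p)%N.
Proof.
have msizeM k l (u v : {mpoly R[n]}) : (msize u <= k.+1)%N ->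
    (msize v <= l.+1)%N -> (msize (u * v) <= (k + l).+1)%N.
  have [->|uv0] := eqVneq (u * v) 0; first by rewrite msize0.
  have u0 : u != 0 by apply: contraNneq uv0 => ->; rewrite mul0r.
  have v0 : v != 0 by apply: contraNneq uv0 => ->; rewrite mulr0.
  rewrite -!mlead_deg // !ltnS => hu hv.
  by apply: leq_trans (lemc_mdeg (mleadM_le u v)) _; rewrite mdegD leq_add.
rewrite comp_mpolyEX; apply: leq_trans (msize_sum _ _ _) _.
apply/bigmax_leqP_seq => m mp _; apply: leq_trans (msizeZ_le _ _) _.
apply: leq_trans (msize_mdeg_lt mp).
rewrite comp_mpolyX mdegE.
apply: (big_ind2 (fun (q : {mpoly R[n]}) k => (msize q <= k.+1)%N)).
- by rewrite msize1.
- by move=> u k v l; apply: msizeM.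
move=> i _; rewrite tnth_mktuple; elim: (m i) => [|k IH].
  by rewrite expr0 msize1.
rewrite exprS; apply: (msizeM 1%N) IH.
apply: leq_trans (msizeD_le _ _) _; rewrite geq_max msizeC.
rewrite (leq_trans (msizeZ_le _ _)) ?msizeX ?mdeg1 //.
by case: (_ != 0).
Qed.

(** Multiplicative statements about substitutions and derivatives are awkward
    to prove monomial by monomial; this principle reduces them to constants and
    variables. *)
Lemma mpoly_alg_ind (R : comNzRingType) (n : nat) (P : {mpoly R[n]} -> Prop) :
  (forall c, P c%:MP) -> (forall i, P 'X_i) ->
  (forall p q, P p -> P q -> P (p + q)) ->
  (forall p q, P p -> P q -> P (p * q)) -> forall p, P p.
Proof.
move=> PC PX PD PM p; rewrite [p]mpolyE.
have P0 : P 0 by rewrite -mpolyC0.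
apply: big_ind => // m _; rewrite -mul_mpolyC; apply: (PM _ _ (PC _)).
rewrite mpolyXE_id; have P1 : P 1 by rewrite -mpolyC1.
apply: big_ind => // i _; elim: (m i) => // k IH.
by rewrite exprS; apply: PM.
Qed.

Lemma submm (n : nat) (m : 'X_{1..n}) : (m - m)%MM = 0%MM.
Proof. by apply/mnmP => i; rewrite mnmBE mnm0E subnn. Qed.

Lemma mderiv_comp_affsub (R : comNzRingType) (n : nat) (s : R)
    (b : 'I_n -> R) i (p : {mpoly R[n]}) :
  (p \mPo affsub s b)^`M(i) = s *: (p^`M(i) \mPo affsub s b).
Proof.
elim/mpoly_alg_ind: p => [c|j|p q hp hq|p q hp hq].
- by rewrite comp_mpolyC !mderivC comp_mpoly0 scaler0.
- rewrite comp_affsubX mderivD mderivZ mderivC addr0 !mderivX comp_mpolyZ mnm1E.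
  case: eqP => [->|_]; last by rewrite !scale0r scaler0.
  by rewrite submm mpolyX0 comp_mpoly1.
- by rewrite !raddfD /= hp hq.
rewrite rmorphM /= !mderivM raddfD /= !rmorphM /= hp hq.
by rewrite scalerDr scalerAl scalerAr.
Qed.

Lemma comp_affsub_shiftK (R : comNzRingType) (n : nat) (b : 'I_n -> R)
    (p : {mpoly R[n]}) :
  (p \mPo affsub 1 b) \mPo affsub 1 (fun i => - b i) = p.
Proof.
elim/mpoly_alg_ind: p => [c|j|p q hp hq|p q hp hq].
- by rewrite !comp_mpolyC.
- rewrite comp_affsubX raddfD /= comp_mpolyZ comp_affsubX comp_mpolyC !scale1r.
  by rewrite rmorphN /= subrK.
- by rewrite !raddfD /= hp hq.
by rewrite !rmorphM /= hp hq.
Qed.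

Lemma comp_affsub0 (R : comNzRingType) (n : nat) (b : 'I_n -> R)
    (p : {mpoly R[n]}) :
  p \mPo affsub 0 b = (p.@[b])%:MP.
Proof.
elim/mpoly_alg_ind: p => [c|j|p q hp hq|p q hp hq].
- by rewrite comp_mpolyC mevalC.
- by rewrite comp_affsubX mevalXU scale0r add0r.
- by rewrite !raddfD /= hp hq.
by rewrite !rmorphM /= hp hq.
Qed.

Lemma comp_affsub_id (R : comNzRingType) (n : nat) (p : {mpoly R[n]}) :
  p \mPo affsub 1 (fun=> 0) = p.
Proof.
elim/mpoly_alg_ind: p => [c|j|p q hp hq|p q hp hq].
- by rewrite comp_mpolyC.
- by rewrite comp_affsubX scale1r addr0.
- by rewrite !raddfD /= hp hq.
by rewrite !rmorphM /= hp hq.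
Qed.

Lemma comp_dilationX (R : comNzRingType) (n : nat) (s : R) (m : 'X_{1..n}) :
  'X_[m] \mPo affsub s (fun=> 0) = s ^+ mdeg m *: 'X_[m].
Proof.
rewrite comp_mpolyX mpolyXE_id mdegE -prodrXr -scaler_prod.
by apply: eq_bigr => i _; rewrite tnth_mktuple mpolyC0 addr0 exprZn.
Qed.

(** * The second Euler operator *)

(** The quadratic form of the Hessian of [p], evaluated at the vector of the
    variables. *)
Definition euler2 (R : nzRingType) (n : nat) (p : {mpoly R[n]}) :=
  \sum_i \sum_j 'X_i * 'X_j * (p^`M(j))^`M(i).

Lemma mulX_mderivX (R : comNzRingType) (n : nat) (m : 'X_{1..n}) i :
  'X_i * ('X_[m])^`M(i) = (m i)%:R *: 'X_[m] :> {mpoly R[n]}.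
Proof.
rewrite mderivX -scalerAr -mpolyXD.
have [->|m_gt0] := posnP (m i); first by rewrite !scale0r.
by rewrite addmC submK // lep1mP -lt0n.
Qed.

(** Monomials are eigenvectors of each [X_i d_i], and
    [X_i X_j d_i d_j = (X_i d_i) (X_j d_j) - (i == j) X_i d_i]. *)
Lemma euler2X (R : comNzRingType) (n : nat) (m : 'X_{1..n}) :
  euler2 'X_[m] = ((mdeg m)%:R ^+ 2 - (mdeg m)%:R) *: 'X_[m] :> {mpoly R[n]}.
Proof.
have E i j : 'X_i * 'X_j * (('X_[m])^`M(j))^`M(i)
    = ((m i)%:R * (m j)%:R - (i == j)%:R * (m i)%:R) *: 'X_[m] :> {mpoly R[n]}.
  have /(congr1 (fun p => 'X_i * p^`M(i))) := mulX_mderivX R m j.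
  rewrite mderivM mderivZ mulrDr mulrA -scalerAr mulX_mderivX scalerA.
  rewrite mulrA [LHS]addrC => /(canRL (addrK _)) ->.
  rewrite [in RHS]scalerBl [(m i)%:R * _]mulrC; congr (_ - _).
  rewrite mderivX mnm1E eq_sym; have [->|_] := eqVneq i j; last first.
    by rewrite !scale0r mulr0 !mul0r scale0r.
  by rewrite submm mpolyX0 scale1r mulr1 mul1r mulX_mderivX.
rewrite /euler2; under eq_bigr do under eq_bigr do rewrite E.
under eq_bigr do rewrite -scaler_suml.
rewrite -scaler_suml; congr (_ *: _).
under eq_bigr do rewrite sumrB -mulr_sumr.
rewrite sumrB -mulr_suml mdegE natr_sum expr2; congr (_ - _).
apply: eq_bigr => i _; rewrite (bigD1 i) //= eqxx mul1r big1 ?addr0 // => j.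
by rewrite eq_sym => /negbTE ->; rewrite mul0r.
Qed.

Lemma euler2E (R : comNzRingType) (n : nat) (p : {mpoly R[n]}) :
  euler2 p = \sum_(m <- msupp p)
    (p@_m * ((mdeg m)%:R ^+ 2 - (mdeg m)%:R)) *: 'X_[m].
Proof.
under [RHS]eq_bigr do rewrite -scalerA -euler2X /euler2 scaler_sumr.
rewrite [LHS]/euler2 [RHS]exchange_big /=; apply: eq_bigr => i _.
under [RHS]eq_bigr do rewrite scaler_sumr.
rewrite [RHS]exchange_big /=; apply: eq_bigr => j _.
under [RHS]eq_bigr do rewrite scalerAr.
rewrite -mulr_sumr {1}[p]mpolyE (raddf_sum (mderiv j)) (raddf_sum (mderiv i)).
by congr (_ * _); apply: eq_bigr => m _; rewrite -!mderivZ.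
Qed.

Lemma msize_euler2 (R : comNzRingType) (n : nat) (p : {mpoly R[n]}) :
  (msize (euler2 p) <= msize p)%N.
Proof.
rewrite euler2E; apply: leq_trans (msize_sum _ _ _) _.
apply/bigmax_leqP_seq => m mp _; apply: leq_trans (msizeZ_le _ _) _.
by rewrite msizeX msize_mdeg_lt.
Qed.

Lemma euler2_sos (R : comNzRingType) (n r : nat) (p : {mpoly R[n]})
    (F : 'M[{mpoly R[n]}]_(r, n)) :
  (forall i j, (p^`M(j))^`M(i) = (F^T *m F) i j) ->
  euler2 p = \sum_k (\sum_j 'X_j * F k j) ^+ 2.
Proof.
move=> hF; rewrite /euler2.
under eq_bigr do under eq_bigr do rewrite hF mxE mulr_sumr.
under eq_bigr do rewrite exchange_big.
rewrite exchange_big; apply: eq_bigr => k _.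
rewrite expr2 mulr_suml; apply: eq_bigr => i _.
rewrite mulr_sumr; apply: eq_bigr => j _.
by rewrite mxE mulrACA.
Qed.

(** * Degrees in a sum of squares *)

(** Let [M] be the largest leading monomial among the [q k], for the
    degree-compatible monomial order.  The coefficient of [M + M] in the sum of
    squares is the sum of the squares of the coefficients of [M] in the [q k];
    over an ordered field it does not vanish, so [M] has degree at most [d]. *)
Lemma msize_sos (R : realFieldType) (n r d : nat) (q : 'I_r -> {mpoly R[n]}) :
  (msize (\sum_k q k ^+ 2) <= (2 * d).+1)%N ->
  forall k, (msize (q k) <= d.+1)%N.
Proof.
move=> hs k0.
have [k _ kmax] :=
  @arg_maxP _ 'X_{1..n} 'I_r k0 xpredT (fun k => mlead (q k)) isT.
have [qk0|qk0] := eqVneq (q k0) 0; first by rewrite qk0 msize0.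
rewrite -mlead_deg // ltnS; apply: leq_trans (lemc_mdeg (kmax k0 isT)) _.
rewrite -(leq_pmul2l (isT : 0 < 2)%N) leqNgt; apply/negP => hd.
have qk : q k != 0.
  by apply: contraTneq hd => ->; rewrite mlead0 mdeg0 muln0.
have /eqP : (\sum_i q i ^+ 2)@_(mlead (q k) + mlead (q k)) = 0.
  apply: memN_msupp_eq0; apply: msize_mdeg_ge; apply: leq_trans hs _.
  by rewrite mdegD addnn -mul2n.
rewrite raddf_sum /= psumr_eq0 => [|i _]; last first.
  have hi : (mlead (q i) <= mlead (q k))%O by apply: kmax.
  by rewrite expr2 (mleadcMW hi hi) -expr2 sqr_ge0.
move=> /allP /(_ k); rewrite mem_index_enum => /(_ isT) /=.
by rewrite expr2 mleadcM mulf_eq0 orbb mleadc_eq0 (negbTE qk).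
Qed.

(** * Restriction of a functional to dilations *)

(** The polynomial [s |-> L (p(s X))], see [horner_radial]. *)
Definition radial (R : comNzRingType) (n : nat) (L : {mpoly R[n]} -> R)
    (p : {mpoly R[n]}) : {poly R} :=
  \sum_(m <- msupp p) (p@_m * L 'X_[m]) *: 'X^(mdeg m).

Lemma horner_radial (R : comNzRingType) (n : nat)
    (L : {scalar {mpoly R[n]}}) (p : {mpoly R[n]}) s :
  (radial L p).[s] = L (p \mPo affsub s (fun=> 0)).
Proof.
rewrite comp_mpolyEX raddf_sum horner_sum; apply: eq_bigr => m _ /=.
rewrite comp_dilationX !linearZ /= hornerZ hornerXn.
by rewrite -mulrA [_ * L _]mulrC.
Qed.

(** The factor [s ^+ 2] makes up for the two powers of [s] lost by
    differentiating, so that the identity holds termwise without division. *)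
Lemma horner_radial_deriv2 (R : comNzRingType) (n : nat)
    (L : {scalar {mpoly R[n]}}) (p : {mpoly R[n]}) s :
  s ^+ 2 * (radial L p)^`()^`().[s] = L (euler2 p \mPo affsub s (fun=> 0)).
Proof.
rewrite euler2E (raddf_sum (comp_mpoly _)) (raddf_sum L).
rewrite /radial !(raddf_sum (@deriv R)) horner_sum mulr_sumr.
apply: eq_bigr => m _ /=.
rewrite comp_mpolyZ comp_dilationX !derivZ derivXn derivMn derivXn !linearZ /=.
rewrite hornerZ !hornerMn hornerXn.
(* in degrees 0 and 1 the exponent of the second derivative is truncated, but
   both sides vanish *)
case: (mdeg m) => [|[|k]] /=.
- by rewrite !mulr0n mulr0 subr0 expr0n !(mulr0, mul0r).
- by rewrite mulr0n mulr1n mulr0 expr1n subrr !(mulr0, mul0r).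
have -> : k.+2%:R ^+ 2 - k.+2%:R = (k.+1 * k.+2)%:R :> R.
  by rewrite natrM; ring.
by rewrite -mulrnA -[_ *+ (_ * _)%N]mulr_natr [s ^+ k.+2](exprD s 2 k); ring.
Qed.

Lemma horner_radial_deriv0 (R : comNzRingType) (n : nat)
    (L : {mpoly R[n]} -> R) (p : {mpoly R[n]}) :
  (forall i, L 'X_i = 0) -> (radial L p)^`().[0] = 0.
Proof.
move=> L0; rewrite horner_coef0 coef_deriv mulr1n /radial coef_sum.
rewrite big1 // => m _; rewrite coefZ coefXn.
case: eqP => [/esym/eqP/mdeg1P[i /eqP->]|_]; last by rewrite mulr0.
by rewrite L0 mulr0 mul0r.
Qed.

Lemma le_horner_deriv2_ge0 (R : rcfType) (f : {poly R}) :
  (forall s, 0 < s -> 0 <= f^`()^`().[s]) -> f^`().[0] = 0 -> f.[0] <= f.[1].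
Proof.
move=> f2 f1; have [c /andP[c0 _] Hc] := poly_mvt f (ltr01 : 0 < 1 :> R).
have {}c0 : 0 < c by move: c0; rewrite bnd_simp.
have [b /andP[b0 _] Hb] := poly_mvt f^`() c0.
have {}b0 : 0 < b by move: b0; rewrite bnd_simp.
rewrite -subr_ge0 Hc subr0 mulr1 -[leRHS]subr0 -[X in _ <= _ - X]f1 Hb subr0.
by rewrite mulr_ge0 ?f2 // ltW.
Qed.

(** * Jensen's inequality for sos-convex polynomials *)

Definition moment_psd (R : realType) (n d : nat) (L : {mpoly R[n]} -> R) :=
  forall q, (msize q <= d.+1)%N -> 0 <= L (q ^+ 2).

(** The radial polynomial of [g] has zero slope at [0] and is convex on the
    positive reals, hence its value [L g] at [1] is at least its value [g(0)] at
    [0]. *)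
Lemma jensen_centered (R : realType) (n d r : nat)
    (L : {scalar {mpoly R[n]}}) (g : {mpoly R[n]})
    (F : 'M[{mpoly R[n]}]_(r, n)) :
  moment_psd d L -> L 1 = 1 -> (forall i, L 'X_i = 0) ->
  (msize g <= (2 * d).+1)%N -> hessian g = F^T *m F ->
  g.@[fun=> 0] <= L g.
Proof.
move=> Lpsd L1 LX g_deg hF.
have gE : euler2 g = \sum_k (\sum_j 'X_j * F k j) ^+ 2.
  by apply: euler2_sos => i j; rewrite -hF mxE.
have -> : g.@[fun=> 0] = (radial L g).[0].
  rewrite horner_radial comp_affsub0 -[_%:MP]mulr1 mul_mpolyC.
  by rewrite linearZ /= L1 mulr1.
have -> : L g = (radial L g).[1] by rewrite horner_radial comp_affsub_id.
apply: le_horner_deriv2_ge0 => [s s0|]; last exact: horner_radial_deriv0.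
rewrite -(pmulr_rge0 _ (exprn_gt0 2 s0)) horner_radial_deriv2 gE.
rewrite (raddf_sum (comp_mpoly _)) (raddf_sum L).
apply: sumr_ge0 => k _ /=; rewrite rmorphXn; apply: Lpsd.
apply: leq_trans (msize_comp_affsub _ _ _) _.
by move: k; apply: msize_sos; rewrite -gE (leq_trans (msize_euler2 _)).
Qed.

(** Translating [f] by [b = (L X_1, ..., L X_n)] and [L] by [-b] reduces to the
    centered case; translation preserves degrees, and acts entrywise on the
    factor [F] of the Hessian. *)
Lemma jensen (R : realType) (n d r : nat)
    (L : {scalar {mpoly R[n]}}) (f : {mpoly R[n]})
    (F : 'M[{mpoly R[n]}]_(r, n)) :
  moment_psd d L -> L 1 = 1 ->
  (msize f <= (2 * d).+1)%N -> hessian f = F^T *m F ->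
  f.@[fun i => L 'X_i] <= L f.
Proof.
move=> Lpsd L1 f_deg hF.
set b := fun i => L 'X_i.
pose T p : {mpoly R[n]} := p \mPo affsub 1 (fun i => - b i).
pose g := f \mPo affsub 1 b.
pose F' := map_mx (fun p => p \mPo affsub 1 b) F.
have -> : f.@[b] = g.@[fun=> 0].
  rewrite comp_mpoly_meval; apply: meval_eq => i.
  by rewrite tnth_mktuple mevalD mevalZ mevalXU mevalC mulr0 add0r.
rewrite -[f in X in _ <= X](comp_affsub_shiftK b) -/g.
have hg : hessian g = F'^T *m F'.
  apply/matrixP => i j.
  rewrite mxE !(mderiv_comp_affsub, scale1r).
  move/matrixP/(_ i j): hF; rewrite !mxE => ->.
  rewrite raddf_sum; apply: eq_bigr => k _.
  by rewrite !mxE /= rmorphM.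
pose LT : {scalar {mpoly R[n]}} := (L \o T).
apply: (@jensen_centered _ _ d r LT) hg => [q q_deg||i|].
- rewrite /= /T rmorphXn; apply: Lpsd.
  by apply: leq_trans (msize_comp_affsub _ _ _) q_deg.
- by rewrite /= /T comp_mpoly1.
- rewrite /= /T comp_affsubX scale1r raddfD /= -[_%:MP]mulr1 mul_mpolyC.
  by rewrite linearZ /= L1 mulr1 subrr.
by apply: leq_trans (msize_comp_affsub _ _ _) f_deg.
Qed.

(** * Moment vectors as linear functionals *)

(** Coefficients of [p] of degree at least [k] are ignored, which makes the
    functional linear on all polynomials. *)
Definition riesz (R : nzRingType) (n k : nat)
    (y : {ffun 'X_{1..n < k} -> R}) (p : {mpoly R[n]}) : R :=
  \sum_a y a * p@_a.

Lemma riesz_is_additive (R : nzRingType) (n k : nat)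
    (y : {ffun 'X_{1..n < k} -> R}) : additive (riesz y).
Proof.
move=> p q; rewrite /riesz -sumrB.
by apply: eq_bigr => a _; rewrite mcoeffB mulrBr.
Qed.

HB.instance Definition _ (R : nzRingType) (n k : nat)
    (y : {ffun 'X_{1..n < k} -> R}) :=
  GRing.isAdditive.Build {mpoly R[n]} R (riesz y) (riesz_is_additive y).

Lemma riesz_is_scalable (R : comNzRingType) (n k : nat)
    (y : {ffun 'X_{1..n < k} -> R}) : scalable_for *%R (riesz y).
Proof.
move=> c p; rewrite /riesz mulr_sumr; apply: eq_bigr => a _.
by rewrite mcoeffZ mulrCA.
Qed.

HB.instance Definition _ (R : comNzRingType) (n k : nat)
    (y : {ffun 'X_{1..n < k} -> R}) :=
  GRing.isScalable.Build R {mpoly R[n]} R _ (riesz y) (riesz_is_scalable y).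

Lemma rieszX (R : nzRingType) (n k : nat)
    (y : {ffun 'X_{1..n < k} -> R}) (a : 'X_{1..n < k}) :
  riesz y 'X_[a] = y a.
Proof.
rewrite /riesz (bigD1 a) //= mcoeffX eqxx mulr1 big1 ?addr0 // => b ba.
by rewrite mcoeffX -bmeqP eq_sym (negbTE ba) mulr0.
Qed.

Lemma riesz_eval (R : comNzRingType) (n k : nat) (v : 'I_n -> R)
    (p : {mpoly R[n]}) : (msize p <= k)%N ->
  riesz [ffun a : 'X_{1..n < k} => ('X_[a]).@[v]] p = p.@[v].
Proof.
move=> hp; rewrite [in RHS](mpolywE hp) raddf_sum /=; apply: eq_bigr => a _.
by rewrite ffunE mevalZ mulrC.
Qed.

(** Both [Gmom] and [Amom] are instances of the left-hand side. *)
Lemma sum_coefmxE (R : realType) (n k p q : nat)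
    (y : {ffun 'X_{1..n < k} -> R}) (M : 'M[{mpoly R[n]}]_(p, q)) :
  \sum_a y a *: coefmx M a = map_mx (riesz y) M.
Proof.
apply/matrixP => i j; rewrite summxE mxE.
by apply: eq_bigr => a _; rewrite !mxE.
Qed.

Lemma qform_map (R : realType) (n m : nat) (L : {scalar {mpoly R[n]}})
    (G : 'M[{mpoly R[n]}]_m) (xi : 'cV[R]_m) :
  (xi^T *m map_mx L G *m xi) 0 0 = L (qform G xi).
Proof.
rewrite /qform !mxE raddf_sum; apply: eq_bigr => j _ /=.
rewrite !mxE !mulr_suml raddf_sum; apply: eq_bigr => i _ /=.
rewrite !mxE -mulrA mul_mpolyC [_ * _%:MP]mulrC mul_mpolyC !linearZ /=.
by ring.
Qed.

Lemma msize_qform (R : realType) (n m k : nat) (G : 'M[{mpoly R[n]}]_m)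
    (xi : 'cV[R]_m) : mxdeg_le G k -> (msize (qform G xi) <= k.+1)%N.
Proof.
move=> hG; rewrite /qform !mxE; apply: leq_trans (msize_sum _ _ _) _.
apply/bigmax_leqP => j _; rewrite !mxE mulr_suml.
apply: leq_trans (msize_sum _ _ _) _; apply/bigmax_leqP => i _.
rewrite !mxE -mulrA mul_mpolyC [_ * _%:MP]mulrC mul_mpolyC.
by do 2!apply: leq_trans (msizeZ_le _ _) _.
Qed.

(** If [v] is the coefficient vector of [q], then [q = v^T [x]_d], so that
    [q^2] is the quadratic form of [[x]_d [x]_d^T] at [v] and the functional
    maps it to [v^T A_d(y) v]. *)
Lemma moment_psd_riesz (R : realType) (n d : nat)
    (y : {ffun 'X_{1..n < (2 * d).+1} -> R}) :
  psdmx (Amom y) -> moment_psd d (riesz y).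
Proof.
move=> [_ Apsd] q q_deg.
pose v : 'cV[R]_#|{: 'X_{1..n < d.+1}}| :=
  \col_i q@_(enum_val i : 'X_{1..n < d.+1}).
suff -> : riesz y (q ^+ 2) = (v^T *m Amom y *m v) 0 0 by apply: Apsd.
rewrite /Amom sum_coefmxE qform_map; congr (riesz y _).
have qE : q%:M = (map_mx (@mpolyC n R) v)^T *m monvec R n d.
  apply/matrixP => i j; rewrite !ord1 !mxE mulr1n {1}(mpolywE q_deg).
  rewrite (reindex _ (onW_bij _ (@enum_val_bij _))) /=; apply: eq_bigr => k _.
  by rewrite !mxE mul_mpolyC.
rewrite /qform mulmxA -qE -mulmxA -[map_mx _ v]trmxK -trmx_mul -qE.
by rewrite tr_scalar_mx -scalar_mxM mxE mulr1n expr2.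
Qed.

Lemma psdmx_mul_tr (R : realType) (k : nat) (u : 'cV[R]_k) : psdmx (u *m u^T).
Proof.
split=> [|w]; first by rewrite trmx_mul trmxK.
rewrite mulmxA -mulmxA -[u^T *m w]trmxK trmx_mul trmxK.
by rewrite !mxE big_ord1 !mxE -expr2 sqr_ge0.
Qed.

(** * Exactness of the relaxation *)

Theorem theorem2p2 (R : realType) (n m d : nat) (G : 'M[{mpoly R[n]}]_m)
  (d_ge1 : (1 <= d)%N)
  (G_sym : (G^T = G)%R)
  (G_deg : mxdeg_le G (2 * d))
  (slater : exists x0 : 'cV[R]_n, pdmx (evalmx G x0))
  (G_sos : matrix_sos_concave G) :
  Sset G = Lset d G.
Proof.
have evalE (x : 'cV[R]_n) : evalmx G x = map_mx (meval (fun k => x k 0)) G.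
  by apply/matrixP => i j; rewrite !mxE.
have rieszU (y : {ffun 'X_{1..n < (2 * d).+1} -> R}) i :
    riesz y 'X_i = y (bm1 d i) by rewrite -rieszX bm1E.
apply/seteqP; split => x /=.
  move=> Gx; pose v k := x k 0.
  pose y := [ffun a : 'X_{1..n < (2 * d).+1} => ('X_[a]).@[v]].
  exists y.
  have yE p q (M : 'M[{mpoly R[n]}]_(p, q)) : mxdeg_le M (2 * d) ->
      \sum_a y a *: coefmx M a = map_mx (meval v) M.
    move=> hM; rewrite sum_coefmxE; apply/matrixP => i j; rewrite !mxE.
    by rewrite riesz_eval.
  split.
  - by rewrite /Gmom yE // -evalE.
  - rewrite /Amom yE => [|i j]; last first.
      rewrite mxE big_ord1 !mxE -mpolyXD msizeX ltnS mdegD.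
      by rewrite mul2n -addnn leq_add // -ltnS; apply: bmdeg.
    by rewrite map_mxM /= -matrix.map_trmx; apply: psdmx_mul_tr.
  - by rewrite ffunE mpolyX0 meval1.
  by move=> i; rewrite -rieszU riesz_eval ?mevalXU // msizeX mdeg1 ltnS muln_gt0.
move=> [y [[_ Gy] Ay y0 xy]].
split=> [|xi]; first by rewrite evalE matrix.map_trmx G_sym.
have [r [F hF]] := G_sos xi.
have y1 : riesz y 1 = 1.
  by rewrite -y0 -(rieszX y bm0) /= mpolyX0.
have hN : hessian (- qform G xi) = F^T *m F.
  by rewrite -hF; apply/matrixP => i j; rewrite !mxE !raddfN.
have degN : (msize (- qform G xi) <= (2 * d).+1)%N.
  by rewrite mmeasureN; apply: msize_qform.
have := jensen (moment_psd_riesz Ay) y1 degN hN.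
rewrite mevalN raddfN /= lerN2.
have /meval_eq -> : (fun i => riesz y 'X_i) =1 (fun i => x i 0).
  by move=> i; rewrite rieszU xy.
move=> le_yx; rewrite evalE qform_map; apply: le_trans le_yx.
by rewrite -qform_map -sum_coefmxE; apply: Gy.
Qed.
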